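(* For every integer $x\ge 2$, \[ \frac{x}{\max_{1\le n\le x}\tau(n)}\;\le\; a(x)\;\le\;\left\lceil \frac{x}{2}\right\rceil . \] In particular, for every $\varepsilon>0$ one has $a(x)\gg_\varepsilon x^{1-\varepsilon}$.
   Context: $\tau(n)$ denotes the number of positive divisors of $n$. For an integer $x\ge1$ the orbit is defined by $n_0=x$, $n_{j+1}=n_j-\tau(n_j)$, and $a(x):=\min\{k\ge 0: n_k\le 0\}$ is the orbit length. *)

(* Defs.v *)
From mathcomp Require Import all_boot all_order all_algebra.
From mathcomp Require Import all_classical all_reals all_analysis.

Set Implicit Arguments.
Unset Strict Implicit.
Unset Printing Implicit Defensive.

Import Order.TTheory GRing.Theory Num.Theory.

Local Open Scope ring_scope.

Definition tau (n : nat) : nat := size (divisors n).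

(* The orbit lives in int, so the subtraction is not truncated. The value
   given to terms following a nonpositive one (through tau `|n|, with
   tau 0 = 0) is a convention that does not affect orbit_length. *)
Fixpoint orbit (x j : nat) : int :=
  if j is i.+1 then orbit x i - (tau `|orbit x i|)%:Z else x%:Z.

Lemma tau_gt0 (n : nat) : (0 < n)%N -> (0 < tau n)%N.
Proof.
move=> n_gt0; rewrite /tau -has_predT; apply/hasP; exists 1%N => //.
by rewrite -dvdn_divisors // dvd1n.
Qed.

Lemma orbit_le (x k : nat) : orbit x k <= (x - k)%:Z.
Proof.
elim: k => [|k IHk] /=; first by rewrite subn0.
have [le0|gt0] := lerP (orbit x k) 0.
  by rewrite lerBlDr (le_trans le0) // -PoszD.
have tau1 : 1 <= (tau `|orbit x k|)%:Z.
  by rewrite lez_nat tau_gt0 // absz_gt0 gt_eqF.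
have kx : (k < x)%N by rewrite -subn_gt0 -ltz_nat (lt_le_trans gt0).
by rewrite subnS predn_int ?subn_gt0 // lerB.
Qed.

Lemma orbit_le0 (x : nat) : exists k : nat, orbit x k <= 0.
Proof. by exists x; rewrite (le_trans (orbit_le x x)) // subnn. Qed.

Definition orbit_length (x : nat) : nat := ex_minn (orbit_le0 x).

(* Main.v *)
Require Import Defs.
From mathcomp Require Import all_boot all_order all_algebra.
From mathcomp Require Import all_classical all_reals all_analysis.
From mathcomp Require Import zify.

Import Order.TTheory GRing.Theory Num.Theory.

Local Open Scope ring_scope.

(** Before reaching a nonpositive value the orbit stays in [1, x], so each step
    subtracts at most [M = max tau], which gives [x <= a(x) * M]; and each step
    from a value [>= 2] subtracts at least 2, while a step from 1 is the last. The asymptotic form follows from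
    the divisor bound [tau n ^ k <= C_k * n], proved one prime power at a time:
    [(e+1)^k <= 2^(k e) <= p^e] when [p >= 2^k], and [(e+1)^k <= k^k * p^e] for
    the fewer than [2^k] remaining primes. *)

Section DivisorBound.

Local Open Scope nat_scope.

(** In the [foldr] behind [divisors], each of the [e] iterations for an entry [(p, e)] lengthens the
    list by [size ds], so its length is multiplied by [e.+1]. *)
Lemma tau_prime_decomp n : 0 < n ->
  tau n = \prod_(f <- prime_decomp n) f.2.+1.
Proof.
move=> n_gt0; rewrite /tau /divisors.
elim: (prime_decomp n) => [|[p e] s IHs] /=; first by rewrite big_nil.
rewrite big_cons -IHs /=; set ds := foldr _ _ s.
elim: e => [|i IHi] /=; first by rewrite mul1n.
by rewrite size_merge size_cat size_map IHi mulSn addnC [in RHS]mulSn mulSn addnC.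
Qed.

(** With [q = e %/ k], [e.+1 <= k * q.+1 <= k * 2 ^ q]; now raise to the power [k] and use
    [q * k <= e]. *)
Lemma expSn_le_exp2 k e : 0 < k -> e.+1 ^ k <= k ^ k * 2 ^ e.
Proof.
move=> k_gt0; have le_e : e.+1 <= k * 2 ^ (e %/ k).
  apply: (@leq_trans (k * (e %/ k).+1)).
    by rewrite mulnC ltn_ceil.
  by rewrite leq_mul2l ltn_expl // orbT.
apply: (@leq_trans ((k * 2 ^ (e %/ k)) ^ k)); first by rewrite leq_exp2r.
by rewrite expnMn -expnM leq_mul2l leq_exp2l // leq_trunc_div orbT.
Qed.

Lemma expSn_le_prime_power k p e : 0 < k -> 1 < p ->
  e.+1 ^ k <= (if p < 2 ^ k then k ^ k else 1) * p ^ e.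
Proof.
move=> k_gt0 p_gt1; case: ltnP => hp.
  apply: leq_trans (expSn_le_exp2 k e k_gt0) _.
  rewrite leq_mul2l; apply/orP; right.
  by case: e => // e; rewrite leq_exp2r.
rewrite mul1n; case: e => [|e]; first by rewrite exp1n.
apply: (@leq_trans ((2 ^ k) ^ e.+1)); last by rewrite leq_exp2r.
by rewrite -expnM mulnC expnM leq_exp2r // ltn_expl.
Qed.

Lemma divisor_bound k n : 0 < k -> 0 < n ->
  tau n ^ k <= (k ^ k) ^ (2 ^ k) * n.
Proof.
move=> k_gt0 n_gt0.
pose K p := if p < 2 ^ k then k ^ k else 1.
(* The primes below [2 ^ k] are distinct members of [iota 0 (2 ^ k)], so at most [2 ^ k] factors
   equal [k ^ k]; the others are 1. *)
have K_le : \prod_(p <- primes n) K p <= (k ^ k) ^ (2 ^ k).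
  rewrite -big_mkcond /= -big_filter big_const_seq count_predT iter_muln_1.
  rewrite leq_pexp2l ?expn_gt0 ?k_gt0 //.
  rewrite -(size_iota 0 (2 ^ k)) uniq_leq_size ?filter_uniq ?primes_uniq //.
  by move=> p; rewrite mem_filter size_iota mem_iota => /andP[].
apply: (@leq_trans ((\prod_(p <- primes n) K p) * n)); last first.
  by rewrite leq_mul2r K_le orbT.
rewrite {3}(prod_prime_decomp n_gt0) tau_prime_decomp // /primes big_map.
rewrite -big_split /=.
rewrite (big_morph (fun m => m ^ k) (fun a b => expnMn a b k) (exp1n k)).
rewrite big_seq [leqRHS]big_seq; apply: leq_prod => -[p e].
case/mem_prime_decomp => p_prime _ _ /=.
exact: expSn_le_prime_power (prime_gt1 p_prime).
Qed.

Lemma tau_ge2 n : 1 < n -> 1 < tau n.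
Proof.
move=> n_gt1; have n_gt0 := ltnW n_gt1.
apply: (@uniq_leq_size _ [:: 1; n]).
  by rewrite /= inE andbT neq_ltn n_gt1.
by move=> d; rewrite !inE -dvdn_divisors // => /orP[] /eqP->.
Qed.

End DivisorBound.

(* MathComp's [fingraph.orbit] would otherwise take precedence. *)
Local Notation orbit := Defs.orbit.

Lemma orbit_length_le0 x : orbit x (orbit_length x) <= 0.
Proof. by rewrite /orbit_length; case: ex_minnP. Qed.

Lemma orbit_gt0 x j : (j < orbit_length x)%N -> 0 < orbit x j.
Proof.
rewrite /orbit_length; case: ex_minnP => m _ min_m lt_jm.
by rewrite ltNge; apply/negP => /min_m; rewrite leqNgt lt_jm.
Qed.

Lemma le_orbit_length_max_tau x :
  (x <= orbit_length x * \max_(1 <= n < x.+1) tau n)%N.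
Proof.
set M := (\max_(1 <= n < x.+1) tau n)%N.
have orbit_ge j : (j <= orbit_length x)%N -> x%:Z - (j * M)%:Z <= orbit x j.
  elim: j => [|j IHj] lt_j; first by rewrite mul0n subr0.
  have := IHj (ltnW lt_j); have := orbit_gt0 x j lt_j; have := orbit_le x j.
  rewrite /=; case: (orbit x j) => // n le_nx n_gt0 le_n.
  (* Positivity and [orbit_le] place [n] in [[1, x]], the range of the maximum. *)
  have : (tau n <= M)%N.
    apply: (@leq_bigmax_seq _ _ xpredT) => //; rewrite mem_index_iota; lia.
  rewrite absz_nat; lia.
have := orbit_ge _ (leqnn _); have := orbit_length_le0 x; lia.
Qed.

(** Positivity of the [j]-th term rules out a last step from 1, which subtracts only 1 but lands on
    0. *)
Lemma orbit_double_le x j : (j <= orbit_length x)%N ->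
  0 < orbit x j -> orbit x j <= x%:Z - (j.*2)%:Z.
Proof.
elim: j => [|j IHj] lt_j; first by rewrite subr0.
have n_gt0 := orbit_gt0 x j lt_j.
have := IHj (ltnW lt_j) n_gt0; move: n_gt0 => /=.
case: (orbit x j) => // n n_gt0 le_n; rewrite absz_nat.
have [n_gt1|n_le1] := ltnP 1 n; first by have := tau_ge2 n n_gt1; lia.
by have -> : n = 1%N by lia.
Qed.

(** At [j = uphalf x] the bound [x - 2 * j] is at most 0, so that term cannot be positive. *)
Lemma orbit_length_le_half x : (orbit_length x <= uphalf x)%N.
Proof.
rewrite leqNgt; apply/negP => lt_h.
have := orbit_gt0 x _ lt_h => h_gt0.
have := orbit_double_le x _ (ltnW lt_h) h_gt0; lia.
Qed.

(** Take [k]-th roots in [divisor_bound], with [k] so large that [1 / k <= eps]. *)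
Lemma max_tau_le_powR (R : realType) (eps : R) : 0 < eps ->
  exists2 C : R, 0 < C &
    forall x : nat, (0 < x)%N ->
      (\max_(1 <= n < x.+1) tau n)%:R <= C * x%:R `^ eps.
Proof.
move=> eps_gt0; set k := (Num.truncn (eps^-1)).+1.
have k_gt0 : (0 < k)%N by [].
have kV_le : (k%:R : R)^-1 <= eps.
  rewrite invf_ple ?posrE ?ltr0n //.
  by rewrite ltW // truncnS_gt.
pose C := ((k ^ k) ^ (2 ^ k))%N.
have C_gt0 : (0 < C)%N by rewrite !expn_gt0.
exists C%:R; first by rewrite ltr0n.
move=> x x_gt0; rewrite big_seq.
apply: (big_ind (fun m : nat => m%:R <= C%:R * x%:R `^ eps)).
- by rewrite mulr_ge0 ?powR_ge0.
- by move=> a b; rewrite /maxn; case: ifP.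
move=> n; rewrite mem_index_iota => /andP[n_gt0 lt_nx].
apply: (@le_trans _ _ (C%:R * x%:R `^ k%:R^-1)); last first.
  by rewrite ler_wpM2l // ler_powR // ler1n.
rewrite -(@ler_pXn2r _ k) ?nnegrE ?mulr_ge0 ?powR_ge0 //.
rewrite exprMn -powR_mulrn ?powR_ge0 // -[X in _ * X]powR_mulrn ?powR_ge0 //.
rewrite -powRrM mulVf ?pnatr_eq0 // powRr1 // powR_mulrn //.
rewrite -!natrX -natrM ler_nat.
apply: leq_trans (divisor_bound k n k_gt0 n_gt0) _.
(* The constant was not replaced by its [k]-th root: [C <= C ^ k] since [C >= 1]. *)
by apply: leq_mul; [exact: (@leq_pexp2l C 1 k) | rewrite -ltnS].
Qed.

Theorem mainTheorem1 (R : realType) :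
  (forall x : nat, (2 <= x)%N ->
     x%:R / (\max_(1 <= n < x.+1) tau n)%:R <= (orbit_length x)%:R :> R /\
     (orbit_length x)%:Z <= Num.ceil (x%:R / 2 : R)) /\
  (forall eps : R, 0 < eps ->
     exists2 c : R, 0 < c &
       forall x : nat, (2 <= x)%N ->
         c * x%:R `^ (1 - eps) <= (orbit_length x)%:R).
Proof.
have lower x : (2 <= x)%N ->
    x%:R / (\max_(1 <= n < x.+1) tau n)%:R <= (orbit_length x)%:R :> R.
  move=> x_ge2; have := le_orbit_length_max_tau x.
  (* A zero maximum would force [x = 0]. *)
  case: (\max_(1 <= n < x.+1) tau n)%N => [|M] le_x; first by lia.
  by rewrite ler_pdivrMr ?ltr0n // -natrM ler_nat.
split=> [x x_ge2|eps eps_gt0].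
  split; first exact: lower.
  apply: (@le_trans _ _ (uphalf x)%:Z).
    by rewrite lez_nat orbit_length_le_half.
  have : x%:R / 2 <= (Num.ceil (x%:R / 2 : R))%:~R :> R by rewrite -ceil_le_int.
  rewrite ler_pdivrMr // -(intrM _ _ 2%:Z) -[x%:R]/(x%:Z%:~R) ler_int; lia.
have [C C_gt0 max_le] := max_tau_le_powR R eps eps_gt0.
exists C^-1 => [|x x_ge2]; first by rewrite invr_gt0.
apply: le_trans (lower x x_ge2).
have x_gt0 : (0 < x)%N by exact: ltnW.
have M_gt0 : (0 < \max_(1 <= n < x.+1) tau n)%N.
  by have := le_orbit_length_max_tau x; case: (\max_(_ <= _ < _) _)%N => //; lia.
rewrite ler_pdivlMr ?ltr0n //.
(* After bounding the maximum by [C * x ^ eps], the constants cancel and the exponents add up to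
   1. *)
apply: (@le_trans _ _ (C^-1 * x%:R `^ (1 - eps) * (C * x%:R `^ eps))).
  by rewrite ler_wpM2l ?mulr_ge0 ?powR_ge0 ?invr_ge0 ?(ltW C_gt0) ?max_le.
rewrite mulrACA mulVf ?gt_eqF // mul1r -powRD ?subrK ?powRr1 //.
by rewrite pnatr_eq0 -lt0n x_gt0 implybT.
Qed.
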